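(* Let $t\geq 3$ be an integer and let $G$ be a finite simple graph that is $K_{1,t}$-free. Then $\varphi(G)\leq (t-1)(\chi(G)-1)+1$.
   Context: $K_{1,t}$ denotes the star with $t$ leaves; $G$ is $K_{1,t}$-free if it contains no induced subgraph isomorphic to $K_{1,t}$. $\chi(G)$ is the chromatic number. A $b$-coloring of $G$ with $b$ colors is a proper coloring of $V(G)$ using exactly $b$ colors such that for every color $i$ there is a vertex of color $i$ (a representative) that has neighbors of all the other $b-1$ colors. The $b$-chromatic number $\varphi(G)$ is the largest $b$ for which $G$ admits a $b$-coloring with $b$ colors. *)

(* Defs.v *)
From mathcomp Require Import all_boot.

Set Implicit Arguments.
Unset Strict Implicit.
Unset Printing Implicit Defensive.

Record sgraph := SGraph {
  vertex :> finType;
  adj : rel vertex;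
  adj_sym : symmetric adj;
  adj_irr : irreflexive adj
}.

Section Induced.
Variables (G : sgraph) (S : {set G}).

Definition induced_adj : rel {x : G | x \in S} :=
  fun x y => adj (val x) (val y).

Lemma induced_adj_sym : symmetric induced_adj.
Proof. by move=> x y; apply: adj_sym. Qed.

Lemma induced_adj_irr : irreflexive induced_adj.
Proof. by move=> x; apply: adj_irr. Qed.

Definition induced : sgraph := SGraph induced_adj_sym induced_adj_irr.
End Induced.

Definition isomorphic (G H : sgraph) : Prop :=
  exists2 f : G -> H, bijective f & forall x y, adj (f x) (f y) = adj x y.

Definition free_of (H G : sgraph) : Prop :=
  ~ exists S : {set G}, isomorphic (induced S) H.

Section Star.
Variable t : nat.

(* The centre is [None]; the leaves are the [Some i]. *)
Definition star_adj : rel (option 'I_t) := fun x y => isSome x != isSome y.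

Lemma star_adj_sym : symmetric star_adj.
Proof. by move=> x y; rewrite /star_adj eq_sym. Qed.

Lemma star_adj_irr : irreflexive star_adj.
Proof. by move=> x; rewrite /star_adj eqxx. Qed.

Definition star : sgraph := SGraph star_adj_sym star_adj_irr.
End Star.

Section Coloring.
Variable G : sgraph.

Definition proper_coloring k (c : {ffun G -> 'I_k}) : bool :=
  [forall x, forall y, adj x y ==> (c x != c y)].

Definition colorable k : bool :=
  [exists c : {ffun G -> 'I_k}, proper_coloring c].

Lemma colorable_card : exists k, colorable k.
Proof.
exists #|G|; apply/existsP; exists [ffun x => enum_rank x].
apply/forallP=> x; apply/forallP=> y; apply/implyP=> xy; rewrite !ffunE.
by apply: contraTneq xy => /enum_rank_inj ->; rewrite adj_irr.
Qed.

Definition chromatic_number : nat := ex_minn colorable_card.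

Definition uses_all_colors k (c : {ffun G -> 'I_k}) : bool :=
  [forall i, exists x, c x == i].

Definition representative k (c : {ffun G -> 'I_k}) (i : 'I_k) (x : G) : bool :=
  (c x == i) && [forall j, (j != i) ==> [exists y, adj x y && (c y == j)]].

Definition b_coloring k (c : {ffun G -> 'I_k}) : bool :=
  [&& proper_coloring c, uses_all_colors c &
      [forall i, exists x, representative c i x]].

Definition b_colorable k : bool :=
  [exists c : {ffun G -> 'I_k}, b_coloring c].

Lemma b_colorable_bound k : b_colorable k -> k <= #|G|.
Proof.
case/existsP=> c /and3P[_ /forallP surj _].
have imc : codom c =i 'I_k.
  by move=> i; have /existsP[x /eqP <-] := surj i; rewrite codom_f.
by rewrite -{1}(card_ord k) -(eq_card imc) leq_image_card.
Qed.

(* A proper coloring with the fewest colors is a b-coloring: if color [i] had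
   no representative, each vertex of color [i] could be recolored. *)
Lemma b_colorable_exists : exists k, b_colorable k.
Proof.
exists chromatic_number; rewrite /chromatic_number.
case: ex_minnP => k /existsP[c cP] kmin; apply/existsP; exists c.
have rep : [forall i, exists x, representative c i x].
  apply: contraT => /forallPn[i /existsPn noi].
  have miss x : exists j, (j != i) && (((c x == j) || (c x == i)) &&
      [forall y, (adj x y && (c x == i)) ==> (c y != j)]).
    have [cx|cx] := eqVneq (c x) i; last first.
      exists (c x); rewrite cx eqxx /=; apply/forallP=> y.
      by rewrite andbF.
    move: (noi x); rewrite /representative cx eqxx /= => /forallPn[j].
    rewrite negb_imply => /andP[ji /existsPn nj]; exists j.
    rewrite ji orbT /=; apply/forallP=> y; apply/implyP=> /andP[xy _].
    by move: (nj y); rewrite xy.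
  pose d x := xchoose (miss x).
  have dP x : (d x != i) && (((c x == d x) || (c x == i)) &&
      [forall y, (adj x y && (c x == i)) ==> (c y != d x)]).
    exact: (xchooseP (miss x)).
  have cN x y : adj x y -> c x != c y.
    by move=> xy; move/forallP/(_ x)/forallP/(_ y): cP; rewrite xy.
  have dN x y : adj x y -> d x != d y.
    move=> xy; have yx : adj y x by rewrite adj_sym.
    have /and3P[_ cdx /forallP/(_ y)] := dP x; rewrite xy /= => Hx.
    have /and3P[_ cdy /forallP/(_ x)] := dP y; rewrite yx /= => Hy.
    have := cN _ _ xy.
    case/orP: cdx => [/eqP <-|cx]; case/orP: cdy => [/eqP <- //|cy].
    - by move: Hy; rewrite cy.
    - by move: Hx; rewrite cx /= eq_sym.
    - by rewrite (eqP cx) (eqP cy) eqxx.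
  case: k c cP kmin i noi miss d dP cN dN => [|k] c cP kmin i noi miss d dP cN dN.
    by case: i {noi miss d dP dN}.
  suff /kmin: colorable k by rewrite ltnn.
  have un x : {j | d x = lift i j}.
    have := dP x; case: (unliftP i (d x)) => [j ->|->]; first by exists j.
    by rewrite eqxx.
  apply/existsP; exists [ffun x => sval (un x)].
  apply/forallP=> x; apply/forallP=> y; apply/implyP=> /dN; rewrite !ffunE.
  apply: contraNneq => e.
  by rewrite (svalP (un x)) (svalP (un y)) e.
apply/and3P; split=> //; apply/forallP=> i.
by have /existsP[x /andP[cx _]] := forallP rep i; apply/existsP; exists x.
Qed.

Definition b_chromatic_number : nat :=
  ex_maxn b_colorable_exists b_colorable_bound.
End Coloring.

(* Main.v *)
Require Import Defs.
From mathcomp Require Import all_boot.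

(** In a proper coloring with [chromatic_number G] colors, the neighbours of a
    vertex [v] miss the color of [v], and those of any other color form an
    independent set, which has at most [t - 1] elements since [G] is star-free.
    Hence every degree is at most [(t - 1) * (chromatic_number G - 1)], whereas
    a representative in a b-coloring with [b] colors has degree at least
    [b - 1]. *)

(** The image of [h] is the forbidden vertex set, so an induced copy can be given as a map out of
    [H]. *)
Lemma embedding_not_free (G H : sgraph) (h : H -> G) :
  injective h -> (forall a b, adj (h a) (h b) = adj a b) -> ~ free_of H G.
Proof.
move=> h_inj h_adj; apply; exists [set h a | a in H].
have hS a : h a \in [set h a | a in H] by apply: imset_f.
pose g a : induced [set h a | a in H] := exist _ (h a) (hS a).
have g_inj : injective g by move=> a b /(congr1 val) /h_inj.
(* Counting makes the injection [g] bijective; its inverse [f] goes from the induced subgraph to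
   [H], as [isomorphic] requires. *)
have /(inj_card_bij g_inj) [f gK fK] : #|induced [set h a | a in H]| <= #|H|.
  by rewrite card_sig; apply: leq_imset_card.
exists f; first by exists g.
by move=> x y; rewrite -h_adj -[in RHS](fK x) -[in RHS](fK y).
Qed.

Lemma star_free_indep_neighbors (t : nat) (G : sgraph) (v : G) (A : {set G}) :
  free_of (star t) G -> {in A, forall x, adj v x} ->
  {in A &, forall x y, ~~ adj x y} -> #|A| < t.
Proof.
move=> G_free vA indepA; rewrite ltnNge; apply/negP => le_tA.
(* The first [t] elements of [A] become the leaves of an induced star centred at [v]. *)
pose leaf (i : 'I_t) : G := enum_val (widen_ord le_tA i).
have leafA i : leaf i \in A by apply: enum_valP.
have leaf_inj : injective leaf.
  by move=> i j /enum_val_inj /(congr1 val) /= /val_inj.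
have leaf_neq i : leaf i <> v.
  by move=> e; move: (vA _ (leafA i)); rewrite e adj_irr.
pose h (o : star t) : G := if o is Some i then leaf i else v.
apply: (@embedding_not_free G (star t) h) G_free.
- move=> [i|] [j|] //= => [/leaf_inj -> // | /leaf_neq // |].
  by move/esym/leaf_neq.
- move=> [i|] [j|] /=; rewrite /star_adj /=.
  + by apply/negbTE/indepA.
  + by rewrite adj_sym vA.
  + by rewrite vA.
  + by rewrite adj_irr.
Qed.

Lemma star_free_degree (t k : nat) (G : sgraph) (v : G) :
  free_of (star t) G -> colorable G k ->
  #|[set x | adj v x]| <= (t - 1) * (k - 1).
Proof.
move=> G_free /existsP[c c_proper].
have c_neq x y : adj x y -> c x != c y.
  by move=> xy; move/forallP/(_ x)/forallP/(_ y)/implyP: c_proper; apply.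
(* Split the neighbours by color; properness leaves only the [k - 1] colors other than [c v]. *)
rewrite -sum1_card (partition_big c (predC1 (c v))) /=; last first.
  by move=> x; rewrite inE eq_sym => /c_neq.
have <- : #|predC1 (c v)| = k - 1 by rewrite cardC1 card_ord subn1.
rewrite mulnC -sum_nat_const; apply: leq_sum => i _.
rewrite sum1dep_card subn1.
set A := finset _; have : #|A| < t; last by case: (t).
apply: (star_free_indep_neighbors _ _ v) => // [x | x y].
  by rewrite !inE => /andP[].
rewrite !inE => /andP[_ /eqP cx] /andP[_ /eqP cy].
by apply/negP => /c_neq; rewrite cx cy eqxx.
Qed.

Lemma representative_degree (G : sgraph) (k : nat) (c : {ffun G -> 'I_k})
    (i : 'I_k) (v : G) :
  representative c i v -> k - 1 <= #|[set x | adj v x]|.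
Proof.
move=> /andP[_ /forallP nbr].
have <- : #|predC1 i| = k - 1 by rewrite cardC1 card_ord subn1.
(* The colors seen on the neighbours of [v] include every color but [i]. *)
apply: leq_trans (leq_imset_card c _); apply: subset_leq_card.
apply/subsetP => j ji.
have /existsP[y /andP[vy /eqP <-]] := implyP (nbr j) ji.
by apply: imset_f; rewrite inE.
Qed.

Theorem theorem1 (t : nat) (t_ge3 : 3 <= t) (G : sgraph)
    (G_free : free_of (star t) G) :
  b_chromatic_number G <= (t - 1) * (chromatic_number G - 1) + 1.
Proof.
rewrite /b_chromatic_number; case: ex_maxnP => b /existsP[d /and3P[_ _ rep]] _.
rewrite /chromatic_number; case: ex_minnP => k col_k _.
(* With no colors the bound is trivial; otherwise a representative of any one color, here [ord0],
   suffices. *)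
case: b d rep => [//|b] d /forallP /(_ ord0) /existsP[v v_rep].
rewrite addn1 ltnS; apply: leq_trans (star_free_degree _ _ _ v G_free col_k).
by have := representative_degree _ _ _ _ _ v_rep; rewrite subn1.
Qed.
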